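(* Let $0<\rho_1<\rho_2<\rho_3<1$ and, for $k=1,2,3$, let $$\sigma_k=\frac{1}{(\rho_3-\rho_1)^{1/3}}\,\frac{2^{2/3}\rho_k^{1/3}}{(1-\rho_k)^{2/3}},\qquad \mu_k=\frac1{\rho_k},\qquad \nu_k=1-\rho_k.$$ For $s,u,\tau\in\mathbb{R}$ put $\Phi(s,u,\tau)=\prod_{k\in\{1,2,3\}}F_{\rm GOE}\big((s-\mu_ku+\nu_k\tau)/\sigma_k\big)$. Then for all fixed $s,u\in\mathbb{R}$: (a) $\displaystyle\lim_{\tau\to-\infty}\Phi\big(s-(1-\rho_1-\rho_2)\tau,\;u+\tau\rho_1\rho_2,\;\tau\big)=\prod_{k\in\{1,2\}}F_{\rm GOE}\big((s-\mu_ku)/\sigma_k\big)$; (b) $\displaystyle\lim_{\tau\to-\infty}\Phi\big(s-(1-\rho_2-\rho_3)\tau,\;u+\tau\rho_2\rho_3,\;\tau\big)=\prod_{k\in\{2,3\}}F_{\rm GOE}\big((s-\mu_ku)/\sigma_k\big)$; (c) $\displaystyle\lim_{\tau\to+\infty}\Phi\big(s-(1-\rho_1-\rho_3)\tau,\;u+\tau\rho_1\rho_3,\;\tau\big)=\prod_{k\in\{1,3\}}F_{\rm GOE}\big((s-\mu_ku)/\sigma_k\big)$.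
   Context: $F_{\rm GOE}$ is the GOE Tracy–Widom distribution function, $F_{\rm GOE}(s)=\exp\big(-\tfrac12\int_s^\infty [q(x)+(x-s)q(x)^2]\,dx\big)$, where $q$ is the Hastings–McLeod solution of $q''=xq+2q^3$ with $q(x)\sim \mathrm{Ai}(x)$ as $x\to+\infty$. *)

(* Defs.v *)
From HB Require Import structures.
From mathcomp Require Import all_boot all_order all_algebra.
From mathcomp Require Import all_classical all_reals all_analysis.

Set Implicit Arguments.
Unset Strict Implicit.
Unset Printing Implicit Defensive.

Import Order.TTheory GRing.Theory Num.Theory.
Import numFieldNormedType.Exports.

Local Open Scope classical_set_scope.
Local Open Scope ring_scope.

(* Ai(x) = (1/pi) * int_0^oo cos(t^3/3 + x t) dt.  The integral converges only
   conditionally, hence the limit of integrals over [0, T]. *)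
Definition airy_Ai (R : realType) (x : R) : R :=
  pi^-1 * lim ((\int[lebesgue_measure]_(t in `[0, T])
                  cos (t ^+ 3 / 3 + x * t)) @[T --> +oo]).

Definition hastings_mcleod (R : realType) (q : R -> R) : Prop :=
  [/\ forall x, derivable q x 1,
      forall x, derivable (derive1 q) x 1,
      forall x, derive1 (derive1 q) x = x * q x + 2 * q x ^+ 3
    & q x / airy_Ai x @[x --> +oo] --> (1 : R)].

(* The distribution function is determined by q, which is kept as a parameter:
   it is meant for the (unique) q such that [hastings_mcleod q]. *)
Definition F_GOE (R : realType) (q : R -> R) (s : R) : R :=
  expR (- (1 / 2) * \int[lebesgue_measure]_(x in `[s, +oo[)
                      (q x + (x - s) * q x ^+ 2)).

(* The index k is represented by the value r = rho_k. *)
Definition sigma (R : realType) (rho1 rho3 r : R) : R :=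
  1 / ((rho3 - rho1) `^ (1 / 3)) *
  (2 `^ (2 / 3) * r `^ (1 / 3) / ((1 - r) `^ (2 / 3))).

Definition mu (R : realType) (r : R) : R := 1 / r.

Definition nu (R : realType) (r : R) : R := 1 - r.

Definition Phi (R : realType) (q : R -> R) (rho1 rho2 rho3 s u tau : R) : R :=
  \prod_(r <- [:: rho1; rho2; rho3])
    F_GOE q ((s - mu r * u + nu r * tau) / sigma rho1 rho3 r).

(* Main.v *)
(* Along each shift two of the arguments of F_GOE do not depend on tau, and the
   third, for k say, is affine in tau with slope
   - (rho_k - rho_i) (rho_k - rho_j) / (rho_k sigma_k), so it tends to +oo. It
   remains that F_GOE tends to 1 at +oo. This follows from the equation
   q'' = x q + 2 q^3 alone, without Airy asymptotics, because q is global: if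
   (q^2)' were positive at some x >= 0, then w = q^2 would grow at least
   linearly, and since q'^2 - q^4 is then nondecreasing,
   w' >= w^(3/2) eventually, which forces blow-up in finite time. So q^2 is
   nonincreasing on [0, +oo[. For x >= 2, h = q q' + q^2 satisfies h' >= 2 h and
   is bounded above, so h <= 0, which says that q^2 e^(2x) is nonincreasing.
   Hence q = O(e^(-x)), and the integral in F_GOE tends to 0. *)
Require Import Defs.
From HB Require Import structures.
From mathcomp Require Import all_boot all_order all_algebra.
From mathcomp Require Import all_classical all_reals all_analysis.
From mathcomp Require Import measurable_realfun ring lra.
Import Order.TTheory GRing.Theory Num.Theory.
Import numFieldNormedType.Exports.
Local Open Scope classical_set_scope.
Local Open Scope ring_scope.

Set Implicit Arguments.
Unset Strict Implicit.

(** * Growth from derivative bounds, and finite-time blow-up *)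

Lemma derive_ge_growth (R : realType) (f df : R -> R) (a k : R) :
  (forall x, a <= x -> is_derive x 1 f (df x)) ->
  (forall x, a <= x -> k <= df x) ->
  forall x y, a <= x -> x <= y -> k * (y - x) <= f y - f x.
Proof.
move=> fdf kdf x y ax xy.
have [c /itvP cxy ->] : exists2 c, c \in `[x, y]%R & f y - f x = df c * (y - x).
  apply: MVT_segment => //.
    by move=> z /itvP zxy; apply: fdf; rewrite (le_trans ax) ?zxy.
  apply: derivable_within_continuous => z /itvP zxy.
  by apply: (@ex_derive _ _ _ _ _ _ _ (fdf z _)); rewrite (le_trans ax) ?zxy.
by rewrite ler_wpM2r ?subr_ge0// kdf// (le_trans ax) ?cxy.
Qed.

Lemma derive_ge0_le (R : realType) (f df : R -> R) (a : R) :
  (forall x, a <= x -> is_derive x 1 f (df x)) ->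
  (forall x, a <= x -> 0 <= df x) ->
  forall x y, a <= x -> x <= y -> f x <= f y.
Proof.
move=> fdf df0 x y ax xy.
by have := derive_ge_growth fdf df0 ax xy; rewrite mul0r subr_ge0.
Qed.

Lemma is_derive1_inv_sqrt (R : realType) (w : R -> R) (x dw : R) :
  0 < w x -> is_derive x 1 w dw ->
  is_derive x 1 (fun y => (Num.sqrt (w y))^-1)
    (- (dw / (2 * (w x * Num.sqrt (w x))))).
Proof.
move=> wx dwx.
have s0 : Num.sqrt (w x) != 0 by rewrite gt_eqF// sqrtr_gt0.
have dsw := is_derive1_comp (is_derive1_sqrt wx) dwx.
have dV := @is_deriveV _ (Num.sqrt \o w) _ _ _ s0 dsw.
apply: is_derive_eq; rewrite -[_ *: _]/(_ * _)/= -[in RHS](sqr_sqrtr (ltW wx)).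
rewrite sqrtr_sqr ger0_norm ?sqrtr_ge0//.
by field.
Qed.

(* [1 / sqrt w] decreases at rate at least 1/2, so it cannot stay positive. *)
Lemma riccati_blowup (R : realType) (w dw : R -> R) (a : R) :
  (forall x : R, a <= x -> is_derive x 1 w (dw x)) ->
  (forall x : R, a <= x -> 0 < w x) ->
  ~ (forall x : R, a <= x -> w x * Num.sqrt (w x) <= dw x).
Proof.
move=> wdw w0 wle.
have dm x : a <= x -> is_derive x 1 (fun y => - (Num.sqrt (w y))^-1)
    (dw x / (2 * (w x * Num.sqrt (w x)))).
  move=> ax; have di := is_derive1_inv_sqrt (w0 x ax) (wdw x ax).
  by apply: is_derive_eq; rewrite opprK.
have m2 x : a <= x -> 2^-1 <= dw x / (2 * (w x * Num.sqrt (w x))).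
  move=> ax; have wx := w0 x ax.
  have ws0 : 0 < w x * Num.sqrt (w x) by rewrite mulr_gt0// sqrtr_gt0.
  rewrite ler_pdivlMr; last by rewrite mulr_gt0.
  by have := wle x ax; lra.
(* Falling at rate at least 1/2 from its value at [a], [1 / sqrt w] would have reached 0 by the
   point [b]. *)
pose b := a + 2 * (Num.sqrt (w a))^-1.
have sa : 0 < (Num.sqrt (w a))^-1 by rewrite invr_gt0 sqrtr_gt0 w0.
have ab : a <= b by rewrite lerDl mulr_ge0// ltW.
have := derive_ge_growth dm m2 (lexx a) ab.
have : 0 < (Num.sqrt (w b))^-1 by rewrite invr_gt0 sqrtr_gt0 w0.
rewrite /b; lra.
Qed.

(** * Monotonicity and exponential decay of global Painlevé II solutions *)

Lemma painleve2_mul_derive_le0 (R : realType) (q p : R -> R) :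
  (forall x : R, is_derive x 1 q (p x)) ->
  (forall x : R, is_derive x 1 p (x * q x + 2 * q x ^+ 3)) ->
  forall x : R, 0 <= x -> q x * p x <= 0.
Proof.
move=> dq dp x0 x0_ge0; rewrite leNgt; apply/negP => d0.
set d := q x0 * p x0 in d0.
(* By the equation, [(q p)'] is a sum of terms that are nonnegative for [x >= 0], so [q p] never
   falls below [d] after [x0]. *)
have dv x : x0 <= x -> is_derive x 1 (fun y : R => q y * p y)
    (p x ^+ 2 + x * q x ^+ 2 + 2 * q x ^+ 4).
  move=> _; have dqx := dq x; have dpx := dp x.
  by apply: is_derive_eq; rewrite -![_ *: _]/(_ * _); ring.
have v_ge x : x0 <= x -> d <= q x * p x.
  move=> x0x; apply: (derive_ge0_le dv _ (lexx x0) x0x) => y x0y.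
  have y0 : 0 <= y by exact: le_trans x0y.
  have xq0 : 0 <= y * q y ^+ 2 by rewrite mulr_ge0 ?sqr_ge0.
  have := sqr_ge0 (p y); have : 0 <= q y ^+ 4 by rewrite exprn_even_ge0.
  lra.
have dw x : x0 <= x -> is_derive x 1 (fun y : R => q y ^+ 2) (2 * (q x * p x)).
  move=> _; have dqx := dq x.
  by apply: is_derive_eq; rewrite -![_ *: _]/(_ * _); ring.
(* Subtracting [q^4] cancels the cubic term of the equation; what remains has the sign of
   [x q p]. *)
have dF x : x0 <= x -> is_derive x 1 (fun y : R => p y ^+ 2 - q y ^+ 4)
    (2 * x * (q x * p x)).
  move=> _; have dqx := dq x; have dpx := dp x.
  by apply: is_derive_eq; rewrite -![_ *: _]/(_ * _); ring.
pose K := q x0 ^+ 4.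
have K0 : 0 <= K by rewrite exprn_even_ge0.
have F_ge x : x0 <= x -> q x ^+ 4 - K <= p x ^+ 2.
  move=> x0x.
  have : p x0 ^+ 2 - q x0 ^+ 4 <= p x ^+ 2 - q x ^+ 4.
    apply: (derive_ge0_le dF _ (lexx x0) x0x) => y x0y.
    by rewrite mulr_ge0 ?(le_trans (ltW d0) (v_ge y x0y))// mulr_ge0// (le_trans x0_ge0).
  have := sqr_ge0 (p x0); rewrite /K; lra.
(* Since [q^2] grows at rate at least [2 d], it exceeds [2 (1 + K)] from [a] on, which is enough for
   [K <= q^4 / 2]. *)
pose a := x0 + (1 + K) / d.
have x0a : x0 <= a by rewrite lerDl divr_ge0// ?addr_ge0// ltW.
have w_ge x : a <= x -> 2 * (1 + K) <= q x ^+ 2.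
  move=> ax; have x0x := le_trans x0a ax.
  have d2 y : x0 <= y -> 2 * d <= 2 * (q y * p y).
    by move=> x0y; rewrite ler_pM2l// v_ge.
  have := derive_ge_growth dw d2 (lexx x0) x0x.
  have : 1 + K <= d * (x - x0) by rewrite mulrC -ler_pdivrMr// lerBrDl.
  have := sqr_ge0 (q x0); lra.
have w0 x : a <= x -> 0 < q x ^+ 2.
  by move=> ax; apply: lt_le_trans (w_ge x ax); lra.
apply: (@riccati_blowup R (fun y => q y ^+ 2) (fun y => 2 * (q y * p y)) a) => // x ax.
  by apply: dw; exact: le_trans ax.
have x0x := le_trans x0a ax.
have v0 := le_trans (ltW d0) (v_ge x x0x).
(* Both sides are nonnegative, so squares are compared: with [w = q^2] and [P = p^2] the claim is
   [w^3 <= 4 w P], which follows from [P >= w^2 - K >= w^2 / 2]. *)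
rewrite -ler_sqr; last 2 first.
- by rewrite nnegrE mulr_ge0 ?sqrtr_ge0 ?sqr_ge0.
- by rewrite nnegrE mulr_ge0.
rewrite exprMn sqr_sqrtr ?sqr_ge0// !exprMn.
have := F_ge x x0x; have := w_ge x ax.
have -> : q x ^+ 4 = (q x ^+ 2) ^+ 2 by rewrite -exprM.
move: (q x ^+ 2) (p x ^+ 2) => w P wK PF.
have KW : K <= w ^+ 2 / 2 by nra.
have := @ler_wpM2l _ w _ (w ^+ 2 / 2) P; nra.
Qed.

Lemma painleve2_exp_decay (R : realType) (q p : R -> R) :
  (forall x : R, is_derive x 1 q (p x)) ->
  (forall x : R, is_derive x 1 p (x * q x + 2 * q x ^+ 3)) ->
  exists2 C, 0 <= C & forall x : R, 2 <= x -> `|q x| <= C * expR (- x).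
Proof.
move=> dq dp.
have two0 (x : R) : 2 <= x -> 0 <= x by move=> ?; lra.
have qp0 (x : R) : 2 <= x -> q x * p x <= 0.
  by move=> /two0; exact: painleve2_mul_derive_le0.
have q40 x : 0 <= q x ^+ 4 by rewrite exprn_even_ge0.
(* This [h] is chosen so that [((q e^x)^2)' = 2 h e^(2x)]. *)
pose h x := q x * p x + q x ^+ 2.
pose dh x := p x ^+ 2 + x * q x ^+ 2 + 2 * q x ^+ 4 + 2 * (q x * p x).
have hdh (x : R) : is_derive x 1 h (dh x).
  have dqx := dq x; have dpx := dp x.
  by apply: is_derive_eq; rewrite -![_ *: _]/(_ * _) /dh; ring.
(* The threshold 2 comes from [h' - 2 h = p^2 + (x - 2) q^2 + 2 q^4]. *)
have dh_ge (x : R) : 2 <= x -> 2 * h x <= dh x.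
  move=> x2; have := q40 x; have := sqr_ge0 (p x).
  have : 2 * q x ^+ 2 <= x * q x ^+ 2 by rewrite ler_wpM2r ?sqr_ge0.
  rewrite /h /dh; lra.
have h_le0 (x0 : R) : 2 <= x0 -> h x0 <= 0.
  move=> x02; rewrite leNgt; apply/negP => c0.
  (* With the integrating factor [e^(-2x)], positivity of [h] propagates from [x0] to the right. *)
  have dg x : x0 <= x -> is_derive x 1 (fun y => h y * expR (- y) ^+ 2)
      ((dh x - 2 * h x) * expR (- x) ^+ 2).
    move=> _; have hx := hdh x.
    by apply: is_derive_eq; rewrite -![_ *: _]/(_ * _); ring.
  have h0 x : x0 <= x -> 0 < h x.
    move=> x0x; have : h x0 * expR (- x0) ^+ 2 <= h x * expR (- x) ^+ 2.
      apply: (derive_ge0_le dg _ (lexx x0) x0x) => y x0y.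
      by rewrite mulr_ge0 ?sqr_ge0// subr_ge0 dh_ge// (le_trans x02).
    move=> hx; have : 0 < h x * expR (- x) ^+ 2.
      by apply: lt_le_trans hx; rewrite mulr_gt0// exprn_gt0// expR_gt0.
    by rewrite pmulr_lgt0// exprn_gt0// expR_gt0.
  have h_ge x : x0 <= x -> h x0 <= h x.
    move=> x0x; apply: (derive_ge0_le (fun x _ => hdh x) _ (lexx x0) x0x) => y x0y.
    have := h0 y x0y; have := dh_ge y (le_trans x02 x0y); lra.
  have dh_ge2 x : x0 <= x -> 2 * h x0 <= dh x.
    by move=> x0x; have := h_ge x x0x; have := dh_ge x (le_trans x02 x0x); lra.
  have dw x : x0 <= x -> is_derive x 1 (fun y : R => - q y ^+ 2) (- (2 * (q x * p x))).
    move=> _; have dqx := dq x.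
    by apply: is_derive_eq; rewrite -![_ *: _]/(_ * _); ring.
  (* Growing at rate at least [2 h(x0)], [h] gains at least [q(x0)^2] up to [y]. But [q p <= 0]
     gives [h(y) <= q(y)^2 <= q(x0)^2], against [h(x0) > 0]. *)
  pose y := x0 + q x0 ^+ 2 / (2 * h x0).
  have x0y : x0 <= y by rewrite lerDl divr_ge0 ?sqr_ge0// mulr_ge0// ltW.
  have : - q x0 ^+ 2 <= - q y ^+ 2.
    apply: (derive_ge0_le dw _ (lexx x0) x0y) => z x0z.
    by have := qp0 z (le_trans x02 x0z); lra.
  have := qp0 y (le_trans x02 x0y).
  have := derive_ge_growth (fun x _ => hdh x) dh_ge2 (lexx x0) x0y.
  rewrite {1}/y addrAC subrr add0r mulrCA divff ?mulr1; last first.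
    by rewrite mulf_neq0// gt_eqF.
  by rewrite {1}/h; lra.
have dk (x : R) : 2 <= x -> is_derive x 1 (fun y : R => - (q y * expR y) ^+ 2)
    (- (2 * h x * expR x ^+ 2)).
  move=> _; have dqx := dq x.
  by apply: is_derive_eq; rewrite -![_ *: _]/(_ * _) /h; ring.
exists `|q 2 * expR 2| => // x x2.
rewrite expRN ler_pdivlMr ?expR_gt0// -[X in _ * X]gtr0_norm ?expR_gt0// -normrM.
rewrite -ler_sqr ?nnegrE// !real_normK ?num_real//.
rewrite -lerN2; apply: (derive_ge0_le dk _ (lexx 2) x2) => y y2.
by rewrite oppr_ge0 mulr_le0_ge0 ?sqr_ge0// mulr_ge0_le0// h_le0.
Qed.

(** * The limit of [F_GOE] at +oo *)

Lemma integral_expRN (R : realType) (a B : R) : 0 <= B ->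
  (\int[lebesgue_measure]_(x in `[a, +oo[) (B * expR (- x))%:E
   = (B * expR (- a))%:E)%E.
Proof.
move=> B0; pose F x : R := - (B * expR (- x)).
have dF (x : R) : is_derive x 1 F (B * expR (- x)).
  by apply: is_derive_eq; rewrite -![_ *: _]/(_ * _); ring.
have cont (f df : R -> R) : (forall x : R, is_derive x 1 f (df x)) -> continuous f.
  by move=> dfx x; apply/differentiable_continuous/derivable1_diffP.
rewrite (@ge0_continuous_FTC2y _ _ F _ 0); first by rewrite sub0e -EFinN opprK.
- by move=> x _; rewrite mulr_ge0 ?expR_ge0.
- apply: continuous_subspaceT.
  have -> : (fun x => B * expR (- x)) = - F by apply/funext => x; rewrite fctE opprK.
  by move=> x; apply: continuousN; exact: cont dF x.
- rewrite -oppr0 -(mulr0 B); apply: cvgN; apply: cvgMr.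
  exact: cvgr_expR.
- by move=> x _; exact: (@ex_derive _ _ _ _ _ _ _ (dF x)).
- by apply: cvg_at_right_filter; exact: cont dF a.
- by move=> x _; rewrite derive1E; exact: (@derive_val _ _ _ _ _ _ _ (dF x)).
Qed.

(** The real integral is the [fine] part of an extended one; the finite integral of the dominating
    [g] excludes infinite values. *)
Lemma le_normr_Rintegral_integral (d : measure_display) (T : measurableType d)
    (R : realType) (m : {measure set T -> \bar R}) (D : set T) (f g : T -> R) (r : R) :
  measurable D -> measurable_fun D f -> measurable_fun D g ->
  (forall x, D x -> `|f x| <= g x) ->
  (\int[m]_(x in D) (g x)%:E = r%:E)%E ->
  `|\int[m]_(x in D) f x| <= r.
Proof.
move=> mD mf mg fg gr.
have : (`|\int[m]_(x in D) (f x)%:E| <= r%:E)%E.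
  rewrite -gr; apply: (le_trans (le_abse_integral _ mD _)); first exact/measurable_EFinP.
  apply: ge0_le_integral => //.
  - by apply/measurable_EFinP/measurableT_comp.
  - exact/measurable_EFinP.
by rewrite /Rintegral; case: (integral _ _ _).
Qed.

Lemma F_GOE_cvg1 (R : realType) (q p : R -> R) :
  (forall x : R, is_derive x 1 q (p x)) ->
  (forall x : R, is_derive x 1 p (x * q x + 2 * q x ^+ 3)) ->
  F_GOE q x @[x --> +oo] --> (1 : R).
Proof.
move=> dq dp; have [C C0 qC] := painleve2_exp_decay dq dp.
have cq : continuous q.
  by move=> x; apply/differentiable_continuous/derivable1_diffP.
pose I (s : R) := \int[lebesgue_measure]_(x in `[s, +oo[) (q x + (x - s) * q x ^+ 2).
have I_le s : 2 <= s -> `|I s| <= (C + C ^+ 2) * expR (- s).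
  move=> s2; apply: (@le_normr_Rintegral_integral _ _ _ lebesgue_measure _ _
    (fun x => (C + C ^+ 2) * expR (- x))) => //.
  - apply: measurable_funTS; apply: continuous_measurable_fun => x.
    apply: cvgD; first exact: cq.
    apply: cvgM; first by apply: cvgB => //; exact: cvg_cst.
    by rewrite /= expr2; apply: cvgM; exact: cq.
  - apply: measurable_funTS; apply: measurable_funM => //.
    exact: measurableT_comp.
  - move=> x /=; rewrite in_itv/= andbT => sx.
    have x2 := le_trans s2 sx; have qx := qC x x2.
    apply: (le_trans (ler_normD _ _)).
    rewrite [leRHS]mulrDl lerD// normrM normrX ger0_norm ?subr_ge0//.
    have q2 : `|q x| ^+ 2 <= C ^+ 2 * expR (- x) ^+ 2.
      by rewrite -exprMn ler_sqr ?nnegrE// mulr_ge0 ?expR_ge0.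
    (* Of the two factors [e^(-x)] bounding [q^2], one absorbs the weight [x - s], as
       [e^x >= 1 + x]; the other is kept for the integrable bound. *)
    have xe : (x - s) * expR (- x) <= 1.
      by rewrite expRN ler_pdivrMr ?expR_gt0// mul1r; have := expR_ge1Dx x; lra.
    apply: (le_trans (ler_wpM2l _ q2)); first by rewrite subr_ge0.
    rewrite mulrCA ler_wpM2l ?sqr_ge0// expr2 mulrA.
    by rewrite -[leRHS]mul1r ler_wpM2r ?expR_ge0.
  - by apply: integral_expRN; rewrite addr_ge0 ?sqr_ge0.
have I0 : I x @[x --> +oo] --> 0.
  apply/norm_cvg0P.
  apply: (@squeeze_cvgr _ _ _ _ (cst 0) (fun x => (C + C ^+ 2) * expR (- x))).
  - by near=> x; rewrite normr_ge0/= I_le.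
  - exact: cvg_cst.
  - by rewrite -(mulr0 (C + C ^+ 2)); apply: cvgMr; exact: cvgr_expR.
rewrite -expR0 -(mulr0 (- (1 / 2) : R)).
by apply: (@cvg_comp _ _ _ (fun x => - (1 / 2) * I x) expR _ (nbhs _));
  [apply: cvgMr | exact: continuous_expR].
Unshelve. all: by end_near. Qed.

(** * Limits along the three affine shifts *)

Lemma cvgy_affine_div (R : realType) (a b c : R) : 0 < c -> b < 0 ->
  (a - b * x) / c @[x --> +oo] --> +oo.
Proof.
move=> c0 b0; apply/cvgryPge => A; near=> x.
by rewrite ler_pdivlMr// lerBrDl -lerBrDr mulrC -ler_ndivrMr//.
Unshelve. all: by end_near. Qed.

Lemma cvgNy_affine_div (R : realType) (a b c : R) : 0 < c -> 0 < b ->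
  (a - b * x) / c @[x --> -oo] --> +oo.
Proof.
move=> c0 b0; apply/cvgryPge => A; near=> x.
by rewrite ler_pdivlMr// lerBrDl -lerBrDr mulrC -ler_pdivlMr//.
Unshelve. all: by end_near. Qed.

Theorem corollary1p2 (R : realType) (q : R -> R) (hq : hastings_mcleod q)
    (rho1 rho2 rho3 : R)
    (h1 : 0 < rho1) (h12 : rho1 < rho2) (h23 : rho2 < rho3) (h3 : rho3 < 1)
    (s u : R) :
  [/\ Phi q rho1 rho2 rho3
        (s - (1 - rho1 - rho2) * tau) (u + tau * rho1 * rho2) tau
        @[tau --> -oo] -->
      \prod_(r <- [:: rho1; rho2]) F_GOE q ((s - mu r * u) / sigma rho1 rho3 r),
      Phi q rho1 rho2 rho3
        (s - (1 - rho2 - rho3) * tau) (u + tau * rho2 * rho3) tau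
        @[tau --> -oo] -->
      \prod_(r <- [:: rho2; rho3]) F_GOE q ((s - mu r * u) / sigma rho1 rho3 r)
    & Phi q rho1 rho2 rho3
        (s - (1 - rho1 - rho3) * tau) (u + tau * rho1 * rho3) tau
        @[tau --> +oo] -->
      \prod_(r <- [:: rho1; rho3]) F_GOE q ((s - mu r * u) / sigma rho1 rho3 r)].
Proof.
have [dq dp ode _] := hq.
have dq' (x : R) : is_derive x 1 q (derive1 q x).
  by rewrite derive1E; apply: derivableP.
have dp' (x : R) : is_derive x 1 (derive1 q) (x * q x + 2 * q x ^+ 3).
  by rewrite -ode derive1E; apply: derivableP.
have F1 := F_GOE_cvg1 dq' dp'.
have sig0 r : 0 < r -> r < 1 -> 0 < sigma rho1 rho3 r.
  move=> r0 r1; have r31 : 0 < rho3 - rho1 by lra.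
  have r1' : 0 < 1 - r by lra.
  by rewrite /sigma mulr_gt0 ?divr_gt0 ?mulr_gt0 ?powR_gt0.
have r1n : rho1 != 0 by rewrite gt_eqF.
have r2n : rho2 != 0 by rewrite gt_eqF//; lra.
have r3n : rho3 != 0 by rewrite gt_eqF//; lra.
(* One identity serves all three shifts: [a], [b] are the two surviving densities, and the
   coefficient of [t] vanishes at both. *)
have argE r a b t : r != 0 ->
    s - (1 - a - b) * t - mu r * (u + t * a * b) + nu r * t =
    s - mu r * u - (r - a) * (r - b) / r * t.
  by move=> r0; rewrite /mu /nu; field.
(* The slope factor [d = (r - a)(r - b) / r] is positive when the vanishing index lies outside the
   surviving pair ([rho3] or [rho1]) and negative for [rho2] between [rho1] and [rho3]; its sign
   fixes the direction of [tau]. *)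
have limNy a r d : 0 < r -> r < 1 -> 0 < d ->
    F_GOE q ((a - d * t) / sigma rho1 rho3 r) @[t --> -oo] --> (1 : R).
  by move=> r0 r1 d0; exact: cvg_comp (cvgNy_affine_div _ (sig0 _ r0 r1) d0) F1.
have limy a r d : 0 < r -> r < 1 -> d < 0 ->
    F_GOE q ((a - d * t) / sigma rho1 rho3 r) @[t --> +oo] --> (1 : R).
  by move=> r0 r1 d0; exact: cvg_comp (cvgy_affine_div _ (sig0 _ r0 r1) d0) F1.
have cvg_mul1l (F : set_system R) (f : R -> R) (c : R) : Filter F ->
    f t @[t --> F] --> (1 : R) -> f t * c @[t --> F] --> c.
  by move=> FF f1; rewrite -[X in _ --> X]mul1r; apply: cvgMl.
rewrite !big_cons !big_nil; split.
- under eq_cvg do rewrite /Phi !big_cons big_nil !argE// !subrr !(mul0r, mulr0) !subr0.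
  apply: cvgMr; apply: cvgMr; apply: cvg_mul1l; apply: limNy.
  + lra.
  + lra.
  + by rewrite divr_gt0 ?mulr_gt0//; lra.
- under eq_cvg do rewrite /Phi !big_cons big_nil !argE// !subrr !(mul0r, mulr0) !subr0.
  apply: cvg_mul1l; apply: limNy.
  + lra.
  + lra.
  + by rewrite divr_gt0 ?nmulr_rgt0//; lra.
- under eq_cvg do rewrite /Phi !big_cons big_nil !argE// !subrr !(mul0r, mulr0) !subr0.
  apply: cvgMr; apply: cvg_mul1l; apply: limy.
  + lra.
  + lra.
  + by rewrite pmulr_llt0 ?invr_gt0 ?pmulr_rlt0//; lra.
Qed.
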